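(* Let $G$ be a completely metrizable topological group with identity $e$, let $d$ be a left-invariant compatible metric on $G$, let $\rho$ be a left-invariant continuous pseudometric on $G$, and let $T\colon G\to G$ be a continuous endomorphism of $G$. Then the following assertions are equivalent: (1) $T$ admits a dense set of mean irregular points; (2) $T$ admits a residual set of mean irregular points; (3) for every sequence $(O_j)_{j\in\mathbb{N}}$ of nonempty open subsets of $G$, there exists a sequence $(K_j)_{j\in\mathbb{N}}$ of Cantor sets with $K_j\subset O_j$ such that $\bigcup_{j=1}^\infty K_j$ is mean Li-Yorke extremely scrambled; (4) the mean proximal relation of $T$ is dense in $G\times G$ and $T$ is mean extremely sensitive.
   Context: A topological group is completely metrizable if its topology is induced by some complete metric. A compatible metric $d$ on $G$ is a metric inducing the topology of $G$ (not required to be complete). A (pseudo)metric $d$ is left-invariant if $d(zx,zy)=d(x,y)$ for all $x,y,z\in G$. A continuous endomorphism is a continuous group homomorphism $G\to G$. $\mathbb{N}$ is the set of positive integers. A set is residual if it contains a dense $G_\delta$ subset. A Cantor set is a subset homeomorphic to the Cantor ternary set. All ''extreme'' and ''irregular'' notions are with respect to the fixed $\rho$: A point $x\in G$ is mean irregular for $T$ if $\liminf_{n\to\infty}\frac1n\sum_{i=1}^n d(T^ix,e)=0$ and $\limsup_{n\to\infty}\frac1n\sum_{i=1}^n \rho(T^ix,e)=\infty$. A pair $(x,y)\in G\times G$ is mean proximal if $\liminf_{n\to\infty}\frac1n\sum_{i=1}^n d(T^ix,T^iy)=0$; the mean proximal relation is the set of all mean proximal pairs. A pair $(x,y)$ is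 mean Li-Yorke extremely chaotic if it is mean proximal and $\limsup_{n\to\infty}\frac1n\sum_{i=1}^n \rho(T^ix,T^iy)=\infty$. A set $K\subset G$ is mean Li-Yorke extremely scrambled if any two distinct points of $K$ form a mean Li-Yorke extremely chaotic pair. $T$ is mean extremely sensitive if for every $x\in G$ and $\varepsilon>0$ there exists $y\in G$ with $d(x,y)<\varepsilon$ satisfying $\limsup_{n\to\infty}\frac1n\sum_{i=1}^n \rho(T^ix,T^iy)=\infty$. *)

(* Defs.v *)
From HB Require Import structures.
From mathcomp Require Import all_boot all_order all_algebra.
From mathcomp Require Import all_classical all_reals all_analysis.
From mathcomp Require Import borel_hierarchy.

Set Implicit Arguments.
Unset Strict Implicit.
Unset Printing Implicit Defensive.

Import Order.TTheory GRing.Theory Num.Theory.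
Import numFieldNormedType.Exports.

Local Open Scope classical_set_scope.
Local Open Scope ring_scope.

(* Not necessarily commutative, not necessarily Hausdorff. *)
HB.mixin Record Group_isTopologicalGroup G of Topological G & Group G := {
  mulg_continuous : continuous (fun p : G * G => (p.1 * p.2)%g) ;
  invg_continuous : continuous (fun x : G => (x^-1)%g)
}.

#[short(type="topologicalGroupType")]
HB.structure Definition TopologicalGroup :=
  {G of Topological G & Group G & Group_isTopologicalGroup G}.

(* Metrics are bare functions X -> X -> R rather than library structures on X,
   since several of them live on the same space. *)
Section Metrics.
Context {R : realType}.

Definition is_pseudometric {X : Type} (d : X -> X -> R) : Prop :=
  [/\ forall x y, 0 <= d x y,
      forall x, d x x = 0,
      forall x y, d x y = d y x &
      forall x y z, d x z <= d x y + d y z].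

Definition is_metric {X : Type} (d : X -> X -> R) : Prop :=
  is_pseudometric d /\ (forall x y, d x y = 0 -> x = y).

Definition induces_topology {X : topologicalType} (d : X -> X -> R) : Prop :=
  forall (x : X) (A : set X),
    nbhs x A <-> exists2 r : R, 0 < r & [set y | d x y < r] `<=` A.

Definition compatible_metric {X : topologicalType} (d : X -> X -> R) : Prop :=
  is_metric d /\ induces_topology d.

Definition complete_metric {X : Type} (d : X -> X -> R) : Prop :=
  is_metric d /\
  forall u : nat -> X,
    (forall eps : R, 0 < eps -> exists N, forall m n,
        (N <= m)%N -> (N <= n)%N -> d (u m) (u n) < eps) ->
    exists l : X, forall eps : R, 0 < eps -> exists N, forall n,
        (N <= n)%N -> d (u n) l < eps.

Definition left_invariant {G : groupType} (d : G -> G -> R) : Prop :=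
  forall x y z : G, d (z * x)%g (z * y)%g = d x y.

Definition continuous_pseudometric {X : topologicalType}
    (d : X -> X -> R) : Prop :=
  is_pseudometric d /\ continuous (fun p : X * X => d p.1 p.2).

End Metrics.

Definition completely_metrizable (R : realType) (X : topologicalType) : Prop :=
  exists d : X -> X -> R, complete_metric d /\ induces_topology d.

Definition residual {X : topologicalType} (A : set X) : Prop :=
  exists B : set X, [/\ Gdelta B, dense B & B `<=` A].

(* The reals having a ternary expansion 0.d_1 d_2 d_3 ... all of whose digits
   are 0 or 2. *)
Definition ternary_cantor (R : realType) : set R :=
  [set x | exists a : nat -> bool,
     x = limn (series (fun k => (if a k then 2 else 0) / 3 ^+ k.+1 : R))].
Arguments ternary_cantor R : clear implicits.

(* f and g are total, but only their restrictions to the (nonempty) ternary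
   set and to K, with the subspace topologies, are constrained. *)
Definition cantor_set (R : realType) {X : topologicalType} (K : set X) : Prop :=
  let C := ternary_cantor R in
  exists (f : R -> X) (g : X -> R),
    [/\ {within C, continuous f}, {within K, continuous g},
        (forall t, C t -> K (f t) /\ g (f t) = t) &
        (forall x, K x -> C (g x) /\ f (g x) = x)].

Section MeanChaos.
Context {R : realType} {G : topologicalGroupType}.
Implicit Types (d rho : G -> G -> R) (T : G -> G) (x y : G).

(* Averages over 1 <= i <= n, for n positive: the entry of index n is the
   average of the first n.+1 terms, starting from i = 1. *)
Definition averages (u : nat -> R) (n : nat) : \bar R :=
  ((n.+1)%:R^-1 * \sum_(1 <= i < n.+2) u i)%:E.

Definition mean_irregular d rho T x : Prop :=
  limn_einf (averages (fun i => d (iter i T x) 1%g)) = 0%E /\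
  limn_esup (averages (fun i => rho (iter i T x) 1%g)) = +oo%E.

Definition mean_proximal d T x y : Prop :=
  limn_einf (averages (fun i => d (iter i T x) (iter i T y))) = 0%E.

Definition mean_proximal_relation d T : set (G * G) :=
  [set p | mean_proximal d T p.1 p.2].

Definition mean_extremely_separated rho T x y : Prop :=
  limn_esup (averages (fun i => rho (iter i T x) (iter i T y))) = +oo%E.

Definition mean_LiYorke_extremely_chaotic d rho T x y : Prop :=
  mean_proximal d T x y /\ mean_extremely_separated rho T x y.

Definition mean_LiYorke_extremely_scrambled d rho T (K : set G) : Prop :=
  forall x y, K x -> K y -> x <> y ->
    mean_LiYorke_extremely_chaotic d rho T x y.

Definition mean_extremely_sensitive d rho T : Prop :=
  forall x (eps : R), 0 < eps ->
    exists y, d x y < eps /\ mean_extremely_separated rho T x y.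

End MeanChaos.

(* Main.v *)
Require Import Defs.
From mathcomp Require Import all_boot all_order all_algebra.
From mathcomp Require Import all_classical all_reals all_analysis.
From mathcomp Require Import zify lra.

Import Order.TTheory GRing.Theory Num.Theory.
Import numFieldNormedType.Exports.

Local Open Scope classical_set_scope.
Local Open Scope ring_scope.

(** Left invariance turns every statement about the pair (x, x * z) into one
about the single point z: since T is an endomorphism,
p (T^i x, T^i (x * z)) = p (T^i z, 1) for p = d and p = rho.  Hence a pair is
mean Li-Yorke extremely chaotic exactly when its left quotient x^-1 * y is mean
irregular ([chaotic_mull]).

Both halves of mean irregularity are infinitely-often conditions on finite
averages, and each finite average is continuous in the point.  So the irregular
points are the intersection of the open sets [near_recurrent k] and
[far_excursion k] ([mean_irregularP]), which makes a dense set of them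
residual.

From residual to scrambled: the preimages of these open sets under
(x, y) |-> x^-1 * y are open dense relations on G that contain no diagonal
point, as the identity is fixed by T.  A Mycielski construction
([mycielski]) then gives, inside the prescribed open sets, copies of the Cantor
space any two distinct points of which satisfy all the relations.  G need not be
separable: only countably many open sets have to be respected, and each stage
refines finitely many pairs of boxes.

From scrambled to proximal and sensitive: two Cantor sets placed near two given
points contain a proximal pair.  If y and z near the identity form a chaotic
pair, then by the triangle inequality y or z has unbounded averages of its
rho-distance to the identity; translating by x gives sensitivity at x.

From there back to a dense set: left quotients of proximal pairs make every
[near_recurrent k] dense, and sensitivity with the same triangle inequality
makes every [far_excursion k] dense.  The Baire theorem concludes; it is the
case of [mycielski] in which the relations are squares of open dense sets. *)

(** * A Mycielski construction in complete metric spaces *)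

Section Mycielski.
Context {R : realType} {X : topologicalType}.
Implicit Types (D : X -> X -> R) (V W : set X) (E : nat -> set (X * X)).

Lemma nbhs_metric_ball D x (r : R) :
  induces_topology D -> 0 < r -> nbhs x [set y | D x y < r].
Proof. by move=> Dtop r0; apply/Dtop; exists r. Qed.

Lemma open_refine D V (eps : R) : is_pseudometric D -> induces_topology D ->
  open V -> V !=set0 -> 0 < eps ->
  exists W, [/\ open W, W !=set0, closure W `<=` V &
    forall x y, W x -> W y -> D x y < eps].
Proof.
move=> [D0 Dxx Dsym Dtri] Dtop oV [x Vx] eps0.
have [r r0 rV] : exists2 r : R, 0 < r & [set y | D x y < r] `<=` V.
  by apply/Dtop; exact: open_nbhs_nbhs.
pose q := Num.min (r / 2) (eps / 2).
have [qr qe] : q <= r / 2 /\ q <= eps / 2 by rewrite !ge_min !lexx ?orbT.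
have q0 : 0 < q by rewrite lt_min !divr_gt0.
(* The closure of the q-ball lies in the 2q-ball, hence in V, and two points of
   the q-ball are at distance less than 2q. *)
exists [set y | D x y < q]^°; split.
- exact: open_interior.
- by exists x; apply: nbhs_metric_ball.
- move=> z /(_ _ (nbhs_metric_ball _ z _ Dtop q0)) [y [/interior_subset xy zy]].
  by apply: rV => /=; move: (Dtri x y z) xy zy => /=; rewrite (Dsym y z); lra.
- move=> y z /interior_subset /= xy /interior_subset /= xz.
  by move: (Dtri y x z); rewrite (Dsym y x); lra.
Qed.

Lemma open_box (A B : set X) : open A -> open B -> open (A `*` B).
Proof.
move=> oA oB; rewrite openE => -[x y] [/= Ax By].
by exists (A, B) => //=; split; exact: open_nbhs_nbhs.
Qed.

(** Density and openness of a relation allow two boxes to be shrunk until their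
product lies in it; a finite list of such demands is met one after the other.
The index type may be infinite, since only the listed indices are touched. *)
Lemma separate_boxes (I : eqType) E (s : seq (nat * (I * I)))
    (V : I -> set X) :
  (forall k, open (E k) /\ dense (E k)) ->
  (forall i, open (V i) /\ V i !=set0) ->
  exists W : I -> set X,
    (forall i, [/\ open (W i), W i !=set0 & W i `<=` V i]) /\
    (forall k i i', (k, (i, i')) \in s -> i <> i' ->
       W i `*` W i' `<=` E k).
Proof.
move=> Eod oV; elim: s => [|[k [i i']] s [W [WV WE]]].
  by exists V; split=> // i; have [oVi nVi] := oV i; split.
have [->|ii'] := eqVneq i i'.
  exists W; split=> // l j j'; rewrite inE => /orP[/eqP[_ -> ->]//|].
  exact: WE.
have [oi [a0 Wa0] _] := WV i; have [oi' [b0 Wb0] _] := WV i'.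
have [oE dE] := Eod k.
have [||[a b] /= [[Wa Wb] Eab]] := dE (W i `*` W i').
- by exists (a0, b0).
- exact: open_box.
have /= [[A B] /= [nA nB] ABE] : nbhs (a, b) (E k) by exact: open_nbhs_nbhs.
pose W' l := if l == i then W i `&` A^° else
             if l == i' then W i' `&` B^° else W l.
have W'W l : W' l `<=` W l.
  by rewrite /W'; case: eqP => [->|_]; [|case: eqP => [->|_]] => // y [].
exists W'; split=> [l|l j j'].
  have [ol nl lV] := WV l; split; last exact: subset_trans (W'W l) lV.
    rewrite /W'; case: eqP => _; [|case: eqP => _] => //; apply: openI => //;
      exact: open_interior.
  by rewrite /W'; case: eqP => _; [exists a|case: eqP => _ //; exists b].
rewrite inE => /orP[/eqP[-> -> ->] _ [x y] [] /=|ls jj' [x y] [/= jx jy]].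
  rewrite /W' eqxx eq_sym (negPf ii') eqxx => -[_ /interior_subset Ax].
  by move=> [_ /interior_subset By]; exact: (ABE (x, y)).
by apply: (WE _ _ _ ls jj'); split; exact: W'W.
Qed.

(** A box of the scheme is addressed by the number of the prescribed open set
that it refines and by a finite word of binary choices. *)
Definition address := (nat * seq bool)%type.

(** Stage n serves only the first n.+1 relations, the first n.+1 prescribed open
sets and the words of length n.+1.  These are finitely many demands, yet
any two distinct infinite addresses are subjected to each relation at some
stage. *)
Lemma scheme_step D E n (V : address -> set X) :
  is_pseudometric D -> induces_topology D ->
  (forall k, open (E k) /\ dense (E k)) ->
  (forall i, open (V i) /\ V i !=set0) ->
  exists W : address -> set X,
    (forall i, [/\ open (W i), W i !=set0, closure (W i) `<=` V i &
       forall x y, W i x -> W i y -> D x y < n.+1%:R^-1]) /\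
    (forall k (i i' : address), (k <= n)%N -> (i.1 <= n)%N -> (i'.1 <= n)%N ->
       size i.2 = n.+1 -> size i'.2 = n.+1 -> i <> i' ->
       W i `*` W i' `<=` E k).
Proof.
move=> Dp Dtop Eod oV.
pose L : seq address :=
  [seq (j, t) | j <- iota 0 n.+1, t <- map val (enum {: n.+1.-tuple bool})].
pose s := [seq (k, p) | k <- iota 0 n.+1, p <- [seq (i, i') | i <- L, i' <- L]].
have inL (i : address) : (i.1 <= n)%N -> size i.2 = n.+1 -> i \in L.
  case: i => j t /= jn st; apply: allpairs_f; first by rewrite mem_iota.
  move/eqP: st => st; apply/mapP; exists (Tuple st) => //.
  by rewrite mem_enum.
have [W [WV WE]] := separate_boxes _ E s V Eod oV.
have /choice[W' W'P] i : exists W',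
    [/\ open W', W' !=set0, closure W' `<=` W i &
    forall x y, W' x -> W' y -> D x y < n.+1%:R^-1].
  by have [oW nW _] := WV i; apply: open_refine => //; rewrite invr_gt0.
have W'W i : W' i `<=` W i.
  have [_ _ + _] := W'P i; apply: subset_trans; exact: subset_closure.
exists W'; split=> [i|k i i' kn i1 i'1 i2 i'2 ii'].
  have [oW nW cW dW] := W'P i; split=> //.
  by apply: subset_trans cW _; have [_ _] := WV i.
apply: subset_trans (WE k i i' _ ii'); last first.
  apply: allpairs_f; first by rewrite mem_iota.
  by apply: allpairs_f; apply: inL.
by apply: setSX; exact: W'W.
Qed.

(** Choosing a point in each set gives a Cauchy sequence; its limit lies in every
closure, which by hypothesis is contained in the preceding set, so the sets
themselves need not be closed. *)
Lemma nested_inter D (W : nat -> set X) : complete_metric D ->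
  induces_topology D -> (forall n, W n !=set0) ->
  (forall n, closure (W n.+1) `<=` W n) ->
  (forall n x y, W n.+1 x -> W n.+1 y -> D x y < n.+1%:R^-1) ->
  exists x, forall n, W n x.
Proof.
move=> [[[_ _ Dsym Dtri] _] Dcomp] Dtop nW cW dW.
have /choice[u Wu] n : exists x, W n x by have [x] := nW n; exists x.
have WS n : W n.+1 `<=` W n by apply: subset_trans (@subset_closure _ _) (cW n).
have Wmono n m : (n <= m)%N -> W m `<=` W n.
  elim: m => [|m IH]; first by rewrite leqn0 => /eqP->.
  rewrite leq_eqVlt => /predU1P[->//|]; rewrite ltnS => nm.
  exact: subset_trans (WS m) (IH nm).
have [eps eps0|l ul] := Dcomp u.
  have [N Neps] : exists N, (N.+1%:R^-1 : R) < eps.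
    by exists (Num.truncn eps^-1); rewrite invf_plt ?posrE// truncnS_gt.
  exists N.+1 => m n Nm Nn; apply: lt_trans Neps.
  by apply: dW; [apply: (Wmono _ _ Nm)|apply: (Wmono _ _ Nn)].
exists l => n; apply: cW => B /Dtop[r r0 rB].
have [N uN] := ul _ r0.
exists (u (maxn N n.+1)); split; first by apply: Wmono (Wu _); rewrite leq_maxr.
by apply: rB => /=; rewrite Dsym; apply: uN; rewrite leq_maxl.
Qed.

(** Mycielski's theorem for countably many open dense relations.  The last two
conclusions say that [x j] is continuous on the Cantor space and open onto its
image.  The latter comes for free when the relations miss the diagonal: from
stage j on, boxes with distinct words are disjoint, since a common point z would
put (z, z) into the first relation. *)
Lemma mycielski D E (O : nat -> set X) :
  complete_metric D -> induces_topology D ->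
  (forall k, open (E k) /\ dense (E k)) ->
  (forall j, open (O j) /\ O j !=set0) ->
  exists x : nat -> (nat -> bool) -> X,
  [/\ forall j a, O j (x j a),
      forall k j a j' a', (j, a) <> (j', a') -> E k (x j a, x j' a'),
      forall j a N, nbhs (x j a) N ->
        exists n, forall b, (forall m, (m < n)%N -> a m = b m) -> N (x j b) &
      (forall k z, ~ E k (z, z)) -> forall j a n,
        exists2 N, nbhs (x j a) N &
          forall b, N (x j b) -> forall m, (m < n)%N -> a m = b m].
Proof.
move=> Dc Dtop Eod oO; have [[Dp _] _] := Dc.
have /choice[F FP] (nV : nat * (address -> set X)) :
    exists W : address -> set X, (forall i, open (nV.2 i) /\ nV.2 i !=set0) ->
    (forall i, [/\ open (W i), W i !=set0, closure (W i) `<=` nV.2 i &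
       forall x y, W i x -> W i y -> D x y < nV.1.+1%:R^-1]) /\
    (forall k (i i' : address), (k <= nV.1)%N -> (i.1 <= nV.1)%N ->
       (i'.1 <= nV.1)%N ->
       size i.2 = nV.1.+1 -> size i'.2 = nV.1.+1 -> i <> i' ->
       W i `*` W i' `<=` E k).
  have [oV|nV0] := pselect (forall i, open (nV.2 i) /\ nV.2 i !=set0).
    by have [W WP] := scheme_step D E nV.1 nV.2 Dp Dtop Eod oV; exists W.
  by exists nV.2.
(* At stage n.+1 the box of a word is cut out of the box of its prefix of
   length n; only words of the stage's own length matter. *)
pose parent n (W : address -> set X) (i : address) := W (i.1, take n i.2).
pose W := fix W n := if n is m.+1 then F (m, parent m (W m))
                     else fun i : address => O i.1.
have Wo n i : open (W n i) /\ W n i !=set0.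
  elim: n i => [|n IH] i /=; first exact: oO.
     have [j|/(_ i)[oW nW _ _] _] := FP (n, parent n (W n)); first exact: IH.
  by split.
have WP n := FP (n, parent n (W n)) (fun i => Wo n _).
pose B j a n := W n (j, mkseq a n).
have mkseq_take (a : nat -> bool) n : take n (mkseq a n.+1) = mkseq a n.
  by rewrite /mkseq -map_take take_iota (minn_idPl (leqnSn n)).
have /choice[x' x'P] (ja : nat * (nat -> bool)) :
    exists x, forall n, B ja.1 ja.2 n x.
  apply: (nested_inter D) => // [n|n|n].
  - by have [] := Wo n (ja.1, mkseq ja.2 n).
  - have [/(_ (ja.1, mkseq ja.2 n.+1))[_ _ + _] _] := WP n.
    by rewrite /parent/= mkseq_take.
  - by have [/(_ (ja.1, mkseq ja.2 n.+1))[_ _ _ +] _] := WP n.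
pose x j a := x' (j, a); have xB j a n : B j a n (x j a) by exact: (x'P (j, a)).
have BE k j a j' a' n : (k <= n)%N -> (j <= n)%N -> (j' <= n)%N ->
    (j, mkseq a n.+1) <> (j', mkseq a' n.+1) ->
    B j a n.+1 `*` B j' a' n.+1 `<=` E k.
  move=> kn jn j'n jj'; have [_ WE] := WP n.
  apply: (WE k (j, mkseq a n.+1) (j', mkseq a' n.+1)) => //;
    exact: size_mkseq.
have eqB j a b n : (forall m, (m < n)%N -> a m = b m) -> B j b n = B j a n.
  move=> ab; rewrite /B; congr (W n (j, _)).
  by apply/eq_in_map => m; rewrite mem_iota => /andP[_ /ab].
have mkseq_inj (a b : nat -> bool) n : mkseq a n = mkseq b n ->
    forall m, (m < n)%N -> a m = b m.
  by move=> ab m mn; rewrite -(nth_mkseq false a mn) ab nth_mkseq.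
exists x; split.
- by move=> j a; exact: (xB j a 0%N).
- move=> k j a j' a' neq.
  have [m mP] : exists m, j = j' -> a m <> a' m.
    apply/not_existsP => neqm; apply: neq; congr pair.
      by have /not_implyP[] := neqm 0%N.
    by apply/funext => m; have /not_implyP[_ /contrapT] := neqm m.
  (* A stage that serves k, j and j', with words long enough to differ. *)
  pose n := (k + j + j' + m)%N.
  apply: (BE k j a j' a' n) => //; rewrite /n; try by lia.
  move=> eq; have jj' := congr1 fst eq; have /mkseq_inj aa' := congr1 snd eq.
  by apply: (mP jj'); apply: aa'; lia.
- move=> j a N /Dtop[r r0 rN].
  pose n := Num.truncn r^-1.
  exists n.+1 => b ab; apply: rN => /=.
  have [/(_ (j, mkseq a n.+1))[_ _ _ dB] _] := WP n.
  apply: (@lt_trans _ _ n.+1%:R^-1); last first.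
    by rewrite invf_plt ?posrE// truncnS_gt.
  apply: dB; first exact: (xB j a n.+1).
  by have := xB j b n.+1; rewrite (eqB _ _ _ _ ab).
- move=> Eirr j a n; pose m := (j + n)%N.
  exists (B j a m.+1).
    apply: open_nbhs_nbhs; split; last exact: xB.
    by have [] := Wo m.+1 (j, mkseq a m.+1).
  move=> b Bb l ln; have [eab|neab] := pselect (mkseq a m.+1 = mkseq b m.+1).
    by apply: (mkseq_inj _ _ _ eab); rewrite /m; lia.
  exfalso; apply: (Eirr 0%N (x j b)).
  apply: (BE 0%N j a j b m) => //; rewrite /m; try by lia.
  by move=> /(congr1 snd).
Qed.

(** Any two points produced by [mycielski] for the relations U k x U k inside a
given open set lie in every U k. *)
Lemma baire D (U : nat -> set X) :
  complete_metric D -> induces_topology D ->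
  (forall k, open (U k) /\ dense (U k)) -> dense (\bigcap_k U k).
Proof.
move=> Dc Dtop Uod V nV oV.
have Eod k : open (U k `*` U k) /\ dense (U k `*` U k).
  have [oU dU] := Uod k; split; first exact: open_box.
  move=> A [[a b] Aab] oA.
  have /= [[P Q] /= [nP nQ] PQA] : nbhs (a, b) A by exact: open_nbhs_nbhs.
  have [|p [/interior_subset Pp Up]] := dU P^° _ (@open_interior _ _).
    by exists a.
  have [|q [/interior_subset Qq Uq]] := dU Q^° _ (@open_interior _ _).
    by exists b.
  by exists (p, q); split=> //; apply: PQA.
have [x [xV xE _ _]] := mycielski D _ (fun=> V) Dc Dtop Eod (fun=> conj oV nV).
exists (x 0%N xpredT); split=> // k _.
by have [|] := xE k 0%N xpredT 1%N xpredT.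
Qed.

End Mycielski.

(** * Ternary expansions and Cantor sets *)

Section Cantor.
Context {R : realType}.
Implicit Types (a b : nat -> bool).

Definition ternary_term a (k : nat) : R := (if a k then 2 else 0) / 3 ^+ k.+1.

Definition ternary a : R := limn (series (ternary_term a)).

Lemma ternary_seriesS a n :
  series (ternary_term a) n.+1 = series (ternary_term a) n + ternary_term a n.
Proof. by rewrite /series /= big_nat_recr. Qed.

(** The digits from place n to place m - 1 contribute at most the geometric sum
of 2 / 3^(k+1), which telescopes to 3^-n - 3^-m. *)
Lemma ternary_partial_bounds a n m : (n <= m)%N ->
  series (ternary_term a) n <= series (ternary_term a) m <=
  series (ternary_term a) n + (3 ^- n - 3 ^- m).
Proof.
elim: m => [|m IH].
  by rewrite leqn0 => /eqP->; rewrite subrr addr0 lexx.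
rewrite leq_eqVlt => /predU1P[->|]; first by rewrite subrr addr0 lexx.
rewrite ltnS => /IH /andP[lo hi].
have t0 : 0 <= (3 ^- m.+1 : R) by rewrite invr_ge0 exprn_ge0.
have tm : 3 ^- m = 3 * 3 ^- m.+1 :> R.
  by rewrite exprS invfM mulrA divff ?mul1r.
rewrite ternary_seriesS /(ternary_term a m); rewrite tm in hi.
by case: (a m); apply/andP; split; lra.
Qed.

Lemma ternary_bounds a n :
  series (ternary_term a) n <= ternary a <= series (ternary_term a) n + 3 ^- n.
Proof.
have cv : cvgn (series (ternary_term a)).
  apply: nondecreasing_is_cvgn.
    by move=> k m km; have /andP[] := ternary_partial_bounds a k m km.
  exists 1 => _ [k _ <-].
  have /andP[_] := ternary_partial_bounds a 0 k (leq0n k).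
  have : 0 <= (3 ^- k : R) by rewrite invr_ge0 exprn_ge0.
  by rewrite {2}/series /= big_geq// expr0 invr1; lra.
apply/andP; split.
  apply: limr_ge => //; exists n => // k /= nk.
  by have /andP[] := ternary_partial_bounds a n k nk.
apply: limr_le => //; exists n => // k /= nk.
have /andP[_] := ternary_partial_bounds a n k nk.
have : 0 <= (3 ^- k : R) by rewrite invr_ge0 exprn_ge0.
by lra.
Qed.

Lemma series_eq a b n : (forall m, (m < n)%N -> a m = b m) ->
  series (ternary_term a) n = series (ternary_term b) n.
Proof.
by move=> ab; apply: eq_big_nat => i /andP[_ /ab]; rewrite /ternary_term => ->.
Qed.

Lemma ternary_agree_close a b n : (forall m, (m < n)%N -> a m = b m) ->
  `|ternary a - ternary b| <= 3 ^- n.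
Proof.
move=> /series_eq ab; have := ternary_bounds a n; have := ternary_bounds b n.
rewrite ab ler_norml => /andP[? ?] /andP[? ?].
by apply/andP; split; lra.
Qed.

(** At the first place l where the digits differ they differ by 2 / 3^(l+1), and
the later digits make up for at most half of it. *)
Lemma ternary_close_agree a b n : `|ternary a - ternary b| < 3 ^- n ->
  forall m, (m < n)%N -> a m = b m.
Proof.
move=> abn m mn; case: (eqVneq (a m) (b m)) => // abm; exfalso.
have ex : exists m, a m != b m by exists m.
case: (ex_minnP ex) => l abl lmin.
have /series_eq abS k : (k < l)%N -> a k = b k.
  by move=> kl; case: (eqVneq (a k) (b k)) => // /lmin; rewrite leqNgt kl.
have ln : (l < n)%N by apply: leq_ltn_trans mn; exact: lmin.
have : 3 ^- n <= 3 ^- l.+1 :> R.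
  by rewrite lef_pV2 ?posrE ?exprn_gt0// ler_weXn2l// ler1n.
have := ternary_bounds a l.+1; have := ternary_bounds b l.+1.
rewrite !ternary_seriesS abS /(ternary_term a l) /(ternary_term b l).
move: abn abl; rewrite ltr_norml.
case: (a l); case: (b l) => // /andP[? ?] _ /andP[? ?] /andP[? ?]; lra.
Qed.

Lemma ternary_inj : injective ternary.
Proof.
move=> a b ab; apply/funext => m.
apply: (ternary_close_agree a b m.+1) => //.
by rewrite ab subrr normr0 invr_gt0 exprn_gt0.
Qed.

(** The two hypotheses say that [x] is a homeomorphism from the Cantor space
onto its image, and the bounds above say the same of [ternary]; the homeomorphism
with the ternary set goes through the common space of binary sequences. *)
Lemma cantor_set_range {X : topologicalType} (x : (nat -> bool) -> X) :
  (forall a N, nbhs (x a) N ->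
     exists n, forall b, (forall m, (m < n)%N -> a m = b m) -> N (x b)) ->
  (forall a n, exists2 N, nbhs (x a) N &
     forall b, N (x b) -> forall m, (m < n)%N -> a m = b m) ->
  cantor_set R (range x).
Proof.
move=> xcont xopen.
(* The inverses of [ternary] and of [x] are total functions; their values off
   the ternary set and off the range are arbitrary. *)
have /choice[inv invP] (t : R) : exists a, ternary_cantor R t -> t = ternary a.
  by have [[a ->]|?] := pselect (ternary_cantor R t); [exists a|exists xpred0].
have /choice[adr adrP] (y : X) : exists a, range x y -> y = x a.
  by have [[a _ <-]|?] := pselect (range x y); [exists a|exists xpred0].
have CP t : ternary_cantor R t -> exists a, t = ternary a by [].
have C a : ternary_cantor R (ternary a) by exists a.
have invK a : inv (ternary a) = a by apply: ternary_inj; rewrite -invP.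
have xinj a b : x a = x b -> a = b.
  move=> ab; apply/funext => m; have [N nN Nb] := xopen a m.+1.
  by apply: Nb => //; rewrite -ab; exact: nbhs_singleton.
have adrK a : adr (x a) = a by apply: xinj; rewrite -adrP//; exists a.
exists (x \o inv), (ternary \o adr); split=> /=.
- apply/subspace_continuousP => _ /CP[a ->] N /=.
   rewrite /from_subspace /= invK => /xcont[n nN].
  apply/nbhs_ballP; exists (3 ^- n); first by rewrite /= invr_gt0 exprn_gt0.
  move=> s /= sa /CP[b sb]; move: sa; rewrite /ball/= sb invK => sa.
  exact/nN/ternary_close_agree.
- apply/subspace_continuousP => _ [a _ <-] N; rewrite /from_subspace /= adrK.
  move=> /nbhs_ballP[eps /= eps0 epsN].
  have [n ne] : exists n, 3 ^- n < eps.
    exists (Num.truncn eps^-1).+1; rewrite invf_plt ?posrE ?exprn_gt0//.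
    apply: (lt_trans (truncnS_gt _)).
    by rewrite -natrX ltr_nat ltn_expl.
  have [M nM Mb] := xopen a n; apply: filterS nM => y My [b _ yb].
  rewrite -yb /= adrK; rewrite -yb in My; apply: epsN; rewrite /ball/=.
  by apply: le_lt_trans ne; apply: ternary_agree_close; exact: Mb.
- by move=> _ /CP[a ->]; rewrite invK adrK; split=> //; exists a.
- by move=> _ [a _ <-]; rewrite adrK invK.
Qed.

Lemma cantor_set_two_points {X : topologicalType} (K : set X) :
  cantor_set R K -> exists x y, [/\ K x, K y & x <> y].
Proof.
move=> [f [g [_ _ fK _]]].
pose a : nat -> bool := xpred0; pose b : nat -> bool := xpredT.
have [fa ga] := fK (ternary a) (ex_intro _ a erefl).
have [fb gb] := fK (ternary b) (ex_intro _ b erefl).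
exists (f (ternary a)), (f (ternary b)); split=> // fab.
have /ternary_inj ab : ternary a = ternary b :> R by rewrite -ga fab gb.
by have := congr1 (fun c => c 0%N) ab.
Qed.

End Cantor.

(** * Upper and lower limits of averages *)

Section Averages.
Context {R : realType}.
Implicit Types (u v w : nat -> R).

Lemma limn_esup_pinftyP v : limn_esup (EFin \o v) = +oo%E <->
  forall k, exists2 n, (k <= n)%N & k%:R < v n.
Proof.
split=> [vy k|vP].
  have : (k%:R%:E < ereal_sup ((EFin \o v) @` [set n | (k <= n)%N]))%E.
    apply: (@lt_le_trans _ _ (limn_esup (EFin \o v))); first by rewrite vy ltry.
    by apply: ereal_inf_lbound; exists [set n | (k <= n)%N] => //; exists k.
  by move=> /ereal_sup_gt[_ [n kn <-]]; rewrite lte_fin; exists n.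
apply/eqyP => A A0; apply: le_ereal_inf_tmp => _ [V [m _ mV] <-].
have [n kn vn] := vP (maxn m (Num.truncn A).+1).
apply: (@le_trans _ _ (v n)%:E); last first.
  apply: ereal_sup_ubound; exists n => //; apply: mV => /=; lia.
rewrite lee_fin; apply/ltW/(lt_trans _ vn)/(lt_le_trans (truncnS_gt _)).
by rewrite ler_nat leq_maxr.
Qed.

Lemma limn_einf_eq0P v : (forall n, 0 <= v n) ->
  limn_einf (EFin \o v) = 0%E <->
  forall k, exists2 n, (k <= n)%N & v n < k.+1%:R^-1.
Proof.
move=> v0.
have einfE : limn_einf (EFin \o v) =
    ereal_sup [set ereal_inf ((EFin \o v) @` V) | V in \oo].
  exact: limf_einfE.
rewrite einfE; split=> [vl k|vP].
  have : (ereal_inf ((EFin \o v) @` [set n | (k <= n)%N]) < k.+1%:R^-1%:E)%E.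
    apply: (@le_lt_trans _ _ 0%E); last by rewrite lte_fin invr_gt0.
    rewrite -vl.
    by apply: ereal_sup_ubound; exists [set n | (k <= n)%N] => //; exists k.
  by move=> /ereal_inf_lt[_ [n kn <-]]; rewrite lte_fin; exists n.
apply/eqP; rewrite eq_le; apply/andP; split.
  apply: ge_ereal_sup => _ [V [m _ mV] <-].
  apply/lee_addgt0Pr => e e0; rewrite add0e.
  have [n kn vn] := vP (maxn m (Num.truncn e^-1)).
  apply: (@le_trans _ _ (v n)%:E).
    apply: ereal_inf_lbound; exists n => //; apply: mV => /=; lia.
  rewrite lee_fin; apply/ltW/(lt_trans vn).
  rewrite invf_plt ?posrE//; apply: (lt_le_trans (truncnS_gt _)).
  by rewrite ler_nat ltnS leq_maxr.
apply: (@le_trans _ _ (ereal_inf ((EFin \o v) @` setT))).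
  by apply: le_ereal_inf_tmp => _ [n _ <-]; rewrite lee_fin.
by apply: ereal_sup_ubound; exists setT => //; exists 0%N.
Qed.

Definition mean u (n : nat) : R := n.+1%:R^-1 * \sum_(1 <= i < n.+2) u i.

Lemma averagesE u : averages u = EFin \o mean u.
Proof. by []. Qed.

Lemma mean_ge0 u n : (forall i, 0 <= u i) -> 0 <= mean u n.
Proof. by move=> u0; rewrite mulr_ge0 ?invr_ge0// sumr_ge0. Qed.

(** If the averages of v and w were eventually bounded by k and l, those of u
would eventually be bounded by k + l. *)
Lemma mean_unbounded_or u v w : (forall i, u i <= v i + w i) ->
  limn_esup (averages u) = +oo%E ->
  limn_esup (averages v) = +oo%E \/ limn_esup (averages w) = +oo%E.
Proof.
move=> uvw; rewrite !averagesE !limn_esup_pinftyP => uy.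
have uvwm n : mean u n <= mean v n + mean w n.
  rewrite /mean -mulrDr -big_split/= ler_wpM2l ?invr_ge0//.
  by apply: ler_sum.
apply: contrapT => /not_orP[/existsNP[k vk] /existsNP[l wl]].
have [n kln un] := uy (k + l)%N.
have vn : mean v n <= k%:R.
  by rewrite leNgt; apply/negP => vn; apply: vk; exists n => //; lia.
have wn : mean w n <= l%:R.
  by rewrite leNgt; apply/negP => wn; apply: wl; exists n => //; lia.
by move: un (uvwm n) vn wn; rewrite natrD; lra.
Qed.

Lemma mean_continuous {X : topologicalType} (u : X -> nat -> R) n :
  (forall i, continuous (u^~ i)) -> continuous (fun x => mean (u x) n).
Proof.
move=> uc x; apply: cvgM; first exact: cvg_cst.
rewrite /= ; elim: n.+2 => [|m IH].
  under eq_fun do rewrite big_geq//. rewrite big_geq//. exact: cvg_cst.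
case: m IH => [|m] IH.
  under eq_fun do rewrite big_geq//. rewrite big_geq//. exact: cvg_cst.
under eq_fun do rewrite big_nat_recr//=.
by rewrite big_nat_recr//=; apply: cvgD => //; exact: uc.
Qed.

Lemma open_frequently_mean_lt {X : topologicalType} (u : X -> nat -> R) k r :
  (forall i, continuous (u^~ i)) ->
  open [set x | exists2 n, (k <= n)%N & mean (u x) n < r].
Proof.
move=> uc.
have -> : [set x | exists2 n, (k <= n)%N & mean (u x) n < r] =
    \bigcup_(n in [set n | (k <= n)%N])
      ((fun x => mean (u x) n) @^-1` [set y | y < r]).
  by apply/seteqP; split=> x [n]; exists n.
apply: bigcup_open => n _; apply: open_comp => [x _|]; last exact: open_lt.
exact: mean_continuous.
Qed.

Lemma open_frequently_mean_gt {X : topologicalType} (u : X -> nat -> R) k r :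
  (forall i, continuous (u^~ i)) ->
  open [set x | exists2 n, (k <= n)%N & r < mean (u x) n].
Proof.
move=> uc.
have -> : [set x | exists2 n, (k <= n)%N & r < mean (u x) n] =
    \bigcup_(n in [set n | (k <= n)%N])
      ((fun x => mean (u x) n) @^-1` [set y | r < y]).
  by apply/seteqP; split=> x [n]; exists n.
apply: bigcup_open => n _; apply: open_comp => [x _|]; last exact: open_gt.
exact: mean_continuous.
Qed.

End Averages.

(** * Irregular points of an endomorphism *)

Section Dynamics.
Context {R : realType} {G : topologicalGroupType}.
Variables (d rho : G -> G -> R) (T : {multiplicative G -> G}).
Hypotheses (hG : completely_metrizable R G)
    (hd : compatible_metric d) (hd_inv : left_invariant d)
    (hrho : continuous_pseudometric rho) (hrho_inv : left_invariant rho)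
    (hT : continuous T).

Definition orbit_dist (p : G -> G -> R) (x : G) (i : nat) : R :=
  p (iter i T x) 1%g.

Lemma iter_mulg i (x y : G) :
  iter i T (x * y)%g = (iter i T x * iter i T y)%g.
Proof. by elim: i => //= i ->; rewrite gmulfM. Qed.

(** By left invariance only the factor z of the second point matters. *)
Lemma orbit_dist_mull (p : G -> G -> R) x z i :
  is_pseudometric p -> left_invariant p ->
  p (iter i T x) (iter i T (x * z)%g) = p (iter i T z) 1%g.
Proof.
move=> [_ _ psym _] pinv.
by rewrite iter_mulg -{1}[iter i T x]mulg1 pinv psym.
Qed.

Lemma orbit_dist_continuous (p : G -> G -> R) i :
  (forall x, {for x, continuous (p^~ 1%g)}) ->
  continuous (fun x => p (iter i T x) 1%g).
Proof.
move=> pc; have Tc : continuous (iter i T).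
  elim: i => [|i IH] x; first exact: cvg_id.
  by apply: continuous_comp; [exact: IH|exact: hT].
move=> x; apply: (@continuous_comp _ _ _ (iter i T) (p^~ 1%g)).
  exact: Tc.
exact: pc.
Qed.

Let dp : is_pseudometric d. Proof. by have [[]] := hd. Qed.
Let rhop : is_pseudometric rho. Proof. by have [] := hrho. Qed.

Lemma d_continuous x : {for x, continuous (d^~ 1%g)}.
Proof.
have [d0 dxx dsym dtri] := dp; have [_ dtop] := hd.
apply/cvgrPdist_lt => e e0; apply/dtop; exists e => // y /= dxy.
rewrite ltr_norml; move: (dtri x y 1%g) (dtri y x 1%g); rewrite (dsym y x) => *.
by apply/andP; split; lra.
Qed.

Lemma rho_continuous x : {for x, continuous (rho^~ 1%g)}.
Proof.
have [_ rc] := hrho.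
apply: (@continuous_comp _ _ _ (fun y => (y, 1%g)) (fun p => rho p.1 p.2)).
  by apply: cvg_pair; [exact: cvg_id|exact: cvg_cst].
exact: rc.
Qed.



(** With index k serving as lower bound for the time and as precision at once,
these sets decrease in k, and their intersections express the lower and the
upper limit in the definition of mean irregularity. *)
Definition near_recurrent k : set G :=
  [set x | exists2 n, (k <= n)%N & mean (orbit_dist d x) n < k.+1%:R^-1].

Definition far_excursion k : set G :=
  [set x | exists2 n, (k <= n)%N & k%:R < mean (orbit_dist rho x) n].

Lemma open_near_recurrent k : open (near_recurrent k).
Proof.
apply: open_frequently_mean_lt => i; apply: orbit_dist_continuous.
exact: d_continuous.
Qed.

Lemma open_far_excursion k : open (far_excursion k).
Proof.
apply: open_frequently_mean_gt => i; apply: orbit_dist_continuous.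
exact: rho_continuous.
Qed.

Lemma near_recurrentP x :
  limn_einf (averages (orbit_dist d x)) = 0%E <-> forall k, near_recurrent k x.
Proof.
have [d0 _ _ _] := dp.
by apply: limn_einf_eq0P => n; apply: mean_ge0 => i; exact: d0.
Qed.

Lemma far_excursionP x :
  limn_esup (averages (orbit_dist rho x)) = +oo%E <->
  forall k, far_excursion k x.
Proof. exact: limn_esup_pinftyP. Qed.

Lemma mean_irregularP x :
  mean_irregular d rho T x <->
  forall k, (near_recurrent k `&` far_excursion k) x.
Proof.
rewrite /mean_irregular.
split=> [[/near_recurrentP xn /far_excursionP xf] k|xk].
  by split; [exact: xn|exact: xf].
by split; [apply/near_recurrentP => k|apply/far_excursionP => k]; case: (xk k).
Qed.

Lemma mean_proximal_mull x z :
  mean_proximal d T x (x * z)%g = (limn_einf (averages (orbit_dist d z)) = 0%E).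
Proof.
by rewrite /mean_proximal; under eq_fun do rewrite orbit_dist_mull//.
Qed.

Lemma mean_separated_mull x z :
  mean_extremely_separated rho T x (x * z)%g =
  (limn_esup (averages (orbit_dist rho z)) = +oo%E).
Proof.
by rewrite /mean_extremely_separated; under eq_fun do rewrite orbit_dist_mull//.
Qed.

Lemma chaotic_mull x z :
  mean_LiYorke_extremely_chaotic d rho T x (x * z)%g = mean_irregular d rho T z.
Proof.
rewrite /mean_LiYorke_extremely_chaotic.
by rewrite mean_proximal_mull mean_separated_mull.
Qed.

Lemma mean_separated_or x y : mean_extremely_separated rho T x y ->
  limn_esup (averages (orbit_dist rho x)) = +oo%E \/
  limn_esup (averages (orbit_dist rho y)) = +oo%E.
Proof.
have [_ _ rsym rtri] := rhop.
apply: mean_unbounded_or => i.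
rewrite /orbit_dist (rsym (iter i T y)); exact: rtri.
Qed.

Lemma mulg_continuousl (x : G) : continuous (fun y => (x * y)%g).
Proof.
move=> y; apply: (@continuous_comp _ _ _ (fun y => (x, y))
  (fun p => (p.1 * p.2)%g)).
  by apply: cvg_pair; [exact: cvg_cst|exact: cvg_id].
exact: mulg_continuous.
Qed.

Definition ldiv (p : G * G) : G := (p.1^-1 * p.2)%g.

Lemma ldiv_continuous : continuous ldiv.
Proof.
move=> p; apply: (@continuous_comp _ _ _ (fun p : G * G => (p.1^-1, p.2)%g)
  (fun p => (p.1 * p.2)%g)); last exact: mulg_continuous.
apply: cvg_pair; last exact: cvg_snd.
apply: (@cvg_comp _ _ _ fst (fun x => x^-1)%g); first exact: cvg_fst.
exact: invg_continuous.
Qed.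

(** With the first coordinate a fixed, left translation by a is a homeomorphism,
so density of A can be used in the second coordinate alone. *)
Lemma dense_ldiv_preimage (A : set G) : dense A -> dense (ldiv @^-1` A).
Proof.
move=> dA O [[a b] Oab] oO.
have /= [[P Q] /= [nP nQ] PQO] : nbhs (a, b) O by exact: open_nbhs_nbhs.
have [||z [/interior_subset Qz Az]] := dA ((fun y => (a * y)%g) @^-1` Q^°).
- by exists (a^-1 * b)%g; rewrite /= mulVKg.
- apply: open_comp => [y _|]; [exact: mulg_continuousl|exact: open_interior].
exists (a, a * z)%g; split; last by rewrite /ldiv /= mulKg.
by apply: PQO; split=> //=; exact: nbhs_singleton.
Qed.

Lemma dense_residual :
  (exists2 A, dense A & (forall x, A x -> mean_irregular d rho T x)) ->
  exists2 A, residual A & (forall x, A x -> mean_irregular d rho T x).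
Proof.
move=> [A dA Airr].
exists (\bigcap_k (near_recurrent k `&` far_excursion k)); last first.
  by move=> x xk; apply/mean_irregularP => k; exact: xk.
exists (\bigcap_k (near_recurrent k `&` far_excursion k)); split=> //.
  exists (fun k => near_recurrent k `&` far_excursion k) => // k.
  by apply: openI; [exact: open_near_recurrent|exact: open_far_excursion].
move=> O O0 oO; have [x [Ox /Airr/mean_irregularP xk]] := dA O O0 oO.
by exists x; split=> // k _; exact: xk.
Qed.

(** The relations x^-1 * y \in near_recurrent k `&` far_excursion k are open and
dense and avoid the diagonal, so [mycielski] provides the Cantor sets. *)
Lemma residual_scrambled :
  (exists2 A, residual A & (forall x, A x -> mean_irregular d rho T x)) ->
  forall O : nat -> set G, (forall j, open (O j) /\ O j !=set0) ->
    exists K : nat -> set G,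
      (forall j, cantor_set R (K j) /\ K j `<=` O j) /\
      mean_LiYorke_extremely_scrambled d rho T (\bigcup_j K j).
Proof.
move=> [A [B [_ dB BA]] Airr] O oO; have [D [Dc Dtop]] := hG.
pose E k := ldiv @^-1` (near_recurrent k `&` far_excursion k).
have Eod k : open (E k) /\ dense (E k).
  split.
    apply: open_comp => [p _|]; first exact: ldiv_continuous.
    by apply: openI; [exact: open_near_recurrent|exact: open_far_excursion].
  apply: dense_ldiv_preimage => V V0 oV.
  have [x [Vx /BA/Airr/mean_irregularP xk]] := dB V V0 oV.
  by exists x.
have [x [xO xE xcont xopen]] := mycielski D E O Dc Dtop Eod oO.
(* The quotient of (z, z) is the identity, whose orbit is constant, so the
   averages of its rho-distance to the identity vanish. *)
have Eirr k z : ~ E k (z, z).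
  rewrite /E /= /ldiv /= mulVg => -[_ [n _]].
  rewrite /mean big1 ?mulr0 ?ltrn0// => i _.
  have [_ rxx _ _] := rhop; rewrite /orbit_dist -[iter i T 1%g]mulg1.
  have T1 : (iter i T 1 * iter i T 1 = iter i T 1)%g.
    by rewrite -iter_mulg mulg1.
  have -> : (iter i T 1 = 1)%g by rewrite -[LHS](mulKg (iter i T 1)%g) T1 mulVg.
  by rewrite mulg1 rxx.
exists (fun j => range (x j)); split=> [j|].
  split; last by move=> _ [a _ <-].
  by apply: cantor_set_range; [exact: xcont|exact: xopen].
move=> _ _ [j _ [a _ <-]] [j' _ [a' _ <-]] neq.
rewrite -(mulVKg (x j a) (x j' a')) chaotic_mull.
apply/mean_irregularP => k; apply: (xE k j a j' a') => -[jj' aa'].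
by apply: neq; rewrite jj' aa'.
Qed.

(** A set with one point could be scrambled vacuously; what carries the proof is
that Cantor sets have at least two points. *)
Lemma scrambled_proximal_sensitive :
  (forall O : nat -> set G, (forall j, open (O j) /\ O j !=set0) ->
    exists K : nat -> set G,
      (forall j, cantor_set R (K j) /\ K j `<=` O j) /\
      mean_LiYorke_extremely_scrambled d rho T (\bigcup_j K j)) ->
  dense (mean_proximal_relation d T) /\ mean_extremely_sensitive d rho T.
Proof.
move=> scr; split.
  move=> O [[a b] Oab] oO.
  have /= [[P Q] /= [nP nQ] PQO] : nbhs (a, b) O by exact: open_nbhs_nbhs.
  have [|K [KO Kscr]] := scr (fun j => if j == 0%N then P^° else Q^°).
    by case=> [|j] /=; split; [exact: open_interior|exists a
                              |exact: open_interior|exists b].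
  have [cK0 K0P] := KO 0%N; have [cK1 K1Q] := KO 1%N.
  have [x [_ [K0x _ _]]] := cantor_set_two_points _ cK0.
  have [y [y' [K1y K1y' yy']]] := cantor_set_two_points _ cK1.
  have [z K1z xz] : exists2 z, K 1%N z & x <> z.
    have [xy|xy] := pselect (x = y); last by exists y.
    by exists y'; rewrite ?xy.
  exists (x, z); split.
    by apply: PQO; split; apply: interior_subset; [exact: K0P|exact: K1Q].
  by have [] := Kscr x z (ex_intro2 _ _ 0%N I K0x) (ex_intro2 _ _ 1%N I K1z) xz.
(* A Cantor set near the identity contains a point w with unbounded averages of
   rho (T^i w, 1); it separates x from x * w. *)
move=> x eps eps0; have [_ dtop] := hd.
have [|K [KO Kscr]] := scr (fun=> [set y | d 1%g y < eps]^°).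
  by split; [exact: open_interior|exists 1%g; exact: nbhs_metric_ball].
have [cK KE] := KO 0%N.
have [y [z [Ky Kz yz]]] := cantor_set_two_points _ cK.
have [_ /mean_separated_or yzsep] :=
  Kscr y z (ex_intro2 _ _ 0%N I Ky) (ex_intro2 _ _ 0%N I Kz) yz.
have [w Kw wsep] : exists2 w, K 0%N w &
    limn_esup (averages (orbit_dist rho w)) = +oo%E.
  by case: yzsep => ?; [exists y|exists z].
exists (x * w)%g; rewrite mean_separated_mull; split=> //.
by rewrite -{1}[x]mulg1 hd_inv; exact: interior_subset (KE _ Kw).
Qed.

(** The two hypotheses supply the density of the two families of open sets
separately, and the Baire theorem makes their intersection dense. *)
Lemma proximal_sensitive_dense :
  dense (mean_proximal_relation d T) /\ mean_extremely_sensitive d rho T ->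
  exists2 A, dense A & (forall x, A x -> mean_irregular d rho T x).
Proof.
move=> [prox sens]; have [D [Dc Dtop]] := hG; have [_ dtop] := hd.
exists (\bigcap_k (near_recurrent k `&` far_excursion k)); last first.
  by move=> x xk; apply/mean_irregularP => k; exact: xk.
apply: (baire D) => // k; split.
  by apply: openI; [exact: open_near_recurrent|exact: open_far_excursion].
apply: denseI; first exact: open_near_recurrent.
  move=> O [z Oz] oO.
  have [||[x y] [/= Oxy]] := prox (ldiv @^-1` O).
  - by exists (z, z * z)%g; rewrite /= /ldiv /= mulKg.
  - by apply: open_comp => [p _|//]; exact: ldiv_continuous.
  rewrite /mean_proximal_relation /= -(mulVKg x y) mean_proximal_mull.
  move=> /near_recurrentP xy.
  by exists (ldiv (x, y)).
move=> O [x Ox] oO.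
have /dtop[r r0 rO] : nbhs x O by exact: open_nbhs_nbhs.
have [y [xy /mean_separated_or sep]] := sens x r r0.
by case: sep => /far_excursionP ?; [exists x|exists y; split => //; exact: rO].
Qed.

End Dynamics.

Theorem theorem4p22 (R : realType) (G : topologicalGroupType)
    (d rho : G -> G -> R) (T : {multiplicative G -> G})
    (hG : completely_metrizable R G)
    (hd : compatible_metric d) (hd_inv : left_invariant d)
    (hrho : continuous_pseudometric rho) (hrho_inv : left_invariant rho)
    (hT : continuous T) :
  [<-> exists2 D : set G, dense D & (forall x, D x -> mean_irregular d rho T x);
       exists2 D : set G, residual D &
         (forall x, D x -> mean_irregular d rho T x);
       forall O : nat -> set G, (forall j, open (O j) /\ O j !=set0) ->
         exists K : nat -> set G,
           (forall j, cantor_set R (K j) /\ K j `<=` O j) /\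
           mean_LiYorke_extremely_scrambled d rho T (\bigcup_j K j);
       dense (mean_proximal_relation d T) /\ mean_extremely_sensitive d rho T].
Proof.
tfae.
- exact: dense_residual.
- exact: residual_scrambled.
- exact: scrambled_proximal_sensitive.
- exact: proximal_sensitive_dense.
Qed.
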